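(* Let $\alpha>0$ and let $\mu$ be a positive Borel measure on $\mathbb{C}$ satisfying condition (M). Then the Toeplitz operator $T_\mu$ is bounded on $F^\infty_\alpha$ if and only if $\tilde{\mu}_1\in L^\infty(\mathbb{C},dA)$.
   Context: $F^\infty_\alpha$ is the space of entire functions $f$ with $\|f\|_{\infty,\alpha}=\sup_{z}|f(z)|e^{-\alpha|z|^2/2}<\infty$. $K_z(w)=e^{\alpha\bar z w}$. $\mu$ satisfies condition (M) if $\int_{\mathbb{C}}|K_z(w)|^2e^{-\alpha|w|^2}\,d\mu(w)<\infty$ for all $z\in\mathbb{C}$. The Toeplitz operator on $F^\infty_\alpha$ is $T_\mu f(z)=\int_{\mathbb{C}}f(w)\overline{K_z(w)}e^{-\alpha|w|^2}\,d\mu(w)$. For $t>0$, $\tilde{\mu}_t(z)=\frac{\alpha}{\pi}\int_{\mathbb{C}}e^{-\alpha t|z-w|^2/2}\,d\mu(w)$; $dA$ is area measure. *)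

(* Defs.v *)
From HB Require Import structures.
From mathcomp Require Import all_boot all_order all_algebra.
From mathcomp Require Import all_classical all_reals all_analysis.
From mathcomp Require Import complex measurable_realfun.
Import Order.TTheory GRing.Theory Num.Theory.
Import numFieldNormedType.Exports.

Set Implicit Arguments.
Unset Strict Implicit.
Unset Printing Implicit Defensive.

Local Open Scope ring_scope.
Local Open Scope complex_scope.

Section Fock.
Variable R : realType.

(* The plane C is identified with R * R, carrying the product of the Borel
   sigma-algebras (= Borel sigma-algebra of R^2); a point w = (x, y) is the
   complex number x + i y. *)
Definition toC (w : R * R) : R[i] := w.1 +i* w.2.

Definition sqn (w : R * R) : R := w.1 ^+ 2 + w.2 ^+ 2.

Definition cabs (z : R[i]) : R := Normc.normc z.

Definition cexp (z : R[i]) : R[i] :=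
  let: a +i* b := z in (expR a * cos b) +i* (expR a * sin b).

Definition Kern (alpha : R) (z w : R[i]) : R[i] :=
  cexp ((alpha +i* 0) * (z^* * w)).

Definition entire (f : R[i] -> R[i]) : Prop :=
  forall z : R[i], derivable (f : R[i]^o -> R[i]^o) z 1.

(* f is in F^infty_alpha with ||f||_{infty,alpha} <= M *)
Definition fock_le (alpha : R) (f : R[i] -> R[i]) (M : R) : Prop :=
  forall z : R[i], cabs (f z) * expR (- (alpha * cabs z ^+ 2) / 2) <= M.

Definition in_Finf (alpha : R) (f : R[i] -> R[i]) : Prop :=
  entire f /\ exists M : R, fock_le alpha f M.

Definition condM (alpha : R)
  (mu : {measure set (R * R)%type -> \bar R}) : Prop :=
  forall z : R[i],
    (\int[mu]_w ((cabs (Kern alpha z (toC w)) ^+ 2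
                  * expR (- (alpha * sqn w)))%:E) < +oo)%E.

Definition toep_integrand (alpha : R) (f : R[i] -> R[i]) (z : R[i])
  (w : R * R) : R[i] :=
  f (toC w) * (Kern alpha z (toC w))^* * (expR (- (alpha * sqn w)) +i* 0).

Definition toep_defined (alpha : R) (mu : {measure set (R * R)%type -> \bar R})
  (f : R[i] -> R[i]) (z : R[i]) : Prop :=
  mu.-integrable setT (fun w => (complex.Re (toep_integrand alpha f z w))%:E) /\
  mu.-integrable setT (fun w => (complex.Im (toep_integrand alpha f z w))%:E).

Definition toeplitz (alpha : R) (mu : {measure set (R * R)%type -> \bar R})
  (f : R[i] -> R[i]) (z : R[i]) : R[i] :=
  (\int[mu]_w complex.Re (toep_integrand alpha f z w))%R
    +i* (\int[mu]_w complex.Im (toep_integrand alpha f z w))%R.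

Definition toeplitz_bounded (alpha : R)
  (mu : {measure set (R * R)%type -> \bar R}) : Prop :=
  exists C : R, forall f : R[i] -> R[i], in_Finf alpha f ->
    (forall z, toep_defined alpha mu f z) /\
    entire (toeplitz alpha mu f) /\
    (forall M : R, fock_le alpha f M -> fock_le alpha (toeplitz alpha mu f) (C * M)).

Definition mu_tilde (alpha t : R) (mu : {measure set (R * R)%type -> \bar R})
  (z : R * R) : \bar R :=
  ((alpha / pi)%:E *
    \int[mu]_w (expR (- (alpha * t * sqn (z.1 - w.1, z.2 - w.2)) / 2))%:E)%E.

Definition Linfty_area (g : R * R -> \bar R) : Prop :=
  measurable_fun setT g /\
  exists M : R, {ae ((@lebesgue_measure R \x @lebesgue_measure R)%E),
                 forall z, (`|g z| <= M%:E)%E}.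

End Fock.

(* Main.v *)
(* For |f(w)| <= M e^{a|w|^2/2}, completing the square gives
     |f(w) K_z(w)| e^{-a|w|^2} <= M e^{a|z|^2/2} e^{-a|z-w|^2/2},
   so a bound for mu~_1 at every point bounds T_mu.  An essential bound is enough:
   e^{-a|z-w|^2/2} is dominated, uniformly in w, by the sum of four such Gaussians
   centred at generic points of the four unit squares with corner z.  The same
   trick absorbs a factor e^{k|w|}, and then the quadratic remainder of the
   exponential makes T_mu f differentiable under the integral sign.
   Conversely, T_mu K_z (z) = e^{a|z|^2} \int e^{-a|z-w|^2} dmu(w), so boundedness of
   T_mu bounds mu~_2; as e^{-a|u|^2/2} is a constant multiple of the convolution of
   e^{-a|u|^2} with itself, Tonelli's theorem, applied one coordinate at a time,
   passes the bound from mu~_2 to mu~_1. *)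
Require Import Defs.
From HB Require Import structures.
From mathcomp Require Import all_boot all_order all_algebra.
From mathcomp Require Import all_classical all_reals all_analysis.
From mathcomp Require Import complex measurable_realfun.
From mathcomp Require Import ring lra.
Import Order.TTheory GRing.Theory Num.Theory.
Import numFieldNormedType.Exports.
Local Open Scope ring_scope.

Set Implicit Arguments.
Unset Strict Implicit.
Unset Printing Implicit Defensive.

(** * Complex modulus and complex differentiability *)

Section Modulus.
Variable R : realType.
Implicit Types (f : R[i] -> R[i]) (z w h L : R[i]).

Lemma cabsM z w : cabs (z * w) = cabs z * cabs w.
Proof. exact: Normc.normcM. Qed.

Lemma cabs_ge0 z : 0 <= cabs z.
Proof. by case: z => a b; rewrite /cabs /= sqrtr_ge0. Qed.

Lemma cabs_eq0 z : cabs z = 0 -> z = 0.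
Proof. exact: Normc.eq0_normc. Qed.

Lemma cabs2 z : cabs z ^+ 2 = complex.Re z ^+ 2 + complex.Im z ^+ 2.
Proof. by case: z => a b; rewrite /cabs /= sqr_sqrtr// addr_ge0// sqr_ge0. Qed.

Lemma cabs_le_ReIm z : cabs z <= `|complex.Re z| + `|complex.Im z|.
Proof.
rewrite -(@ler_pXn2r _ 2) ?nnegrE ?cabs_ge0 ?addr_ge0//.
rewrite cabs2 -[leLHS]addr0 -(real_normK (num_real (complex.Re z))).
rewrite -(real_normK (num_real (complex.Im z))).
have := mulr_ge0 (normr_ge0 (complex.Re z)) (normr_ge0 (complex.Im z)).
by move=> ?; lra.
Qed.

Lemma Re_le_cabs z : `|complex.Re z| <= cabs z.
Proof.
by rewrite -(@ler_pXn2r _ 2) ?nnegrE ?cabs_ge0// cabs2 real_normK ?num_real// lerDl sqr_ge0.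
Qed.

Lemma Im_le_cabs z : `|complex.Im z| <= cabs z.
Proof.
by rewrite -(@ler_pXn2r _ 2) ?nnegrE ?cabs_ge0// cabs2 real_normK ?num_real// lerDr sqr_ge0.
Qed.

Lemma normCE z : `|z| = (cabs z +i* 0)%C.
Proof. by []. Qed.

(** A quadratic remainder keeps the difference quotient within [C * cabs h] of [L]. In this form
    differentiability of the kernels and of [toeplitz alpha mu f] reduces to Taylor bounds. *)
Lemma derivable_quadratic f z L (C : R) :
  (forall h, cabs h <= 1 -> cabs (f (h + z) - f z - h * L) <= C * cabs h ^+ 2) ->
  derivable (f : R[i]^o -> R[i]^o) z 1.
Proof.
move=> H; have C0 : 0 <= C.
  have := H 1; rewrite /cabs Normc.normc1 expr1n mulr1 => /(_ (lexx _)).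
  exact: le_trans (cabs_ge0 _).
apply/cvg_ex; exists (L : R[i]^o); apply/cvgrPdist_le => /= e.
(* A positive element of [R[i]] is real, so the tolerance is its real part. *)
case: e => e e'; rewrite ltcE /= => /andP[/eqP -> e0].
(* The 1 keeps [h] in the range of the hypothesis; [C + 1] avoids division by zero when [C = 0]. *)
have d0 : 0 < Num.min 1 (e / (C + 1)).
  by rewrite lt_min ltr01/= divr_gt0// ltr_wpDl.
near=> h.
have h0 : h != 0 by near: h; exact: (nbhs_dnbhs_neq (0:R[i]^o)).
have hd : cabs h <= Num.min 1 (e / (C + 1)).
  suff : `|h| <= (Num.min 1 (e / (C + 1)))%:C%C by rewrite normCE lecR.
  near: h; apply: (@dnbhs0_le _ R[i]^o).
  by rewrite ltcR.
move: hd; rewrite le_min => /andP[h1 he].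
have hp : 0 < cabs h.
  by rewrite lt_neqAle cabs_ge0 andbT eq_sym; apply/eqP => /cabs_eq0/eqP; exact/negP.
rewrite /GRing.scale /= mulr1 /=.
have -> : L - h^-1 * (f (h + z) - f z) = - (h^-1 * (f (h + z) - f z - h * L)).
  by rewrite [in RHS]mulrBr mulrA mulVf// mul1r opprB.
rewrite normrN normCE lecE /= eqxx /= cabsM /cabs Normc.normcV.
rewrite ler_pdivrMl//.
apply: (le_trans (H _ h1)).
rewrite -/(cabs h) expr2 mulrCA ler_wpM2l ?cabs_ge0//.
move: he; rewrite ler_pdivlMr ?ltr_wpDl//; apply: le_trans.
by rewrite mulrC ler_wpM2l ?cabs_ge0// lerDl.
Unshelve. all: by end_near.
Qed.

Lemma entire_continuous f z (e : R) : entire f -> 0 < e ->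
  exists2 d, 0 < d & forall w, cabs (w - z) < d -> cabs (f w - f z) < e.
Proof.
move=> /(_ z)/derivable1_diffP/differentiable_continuous/cvgrPdist_lt H e0.
have /= := H (e +i* 0)%C; rewrite ltcE /= eqxx e0 => /(_ isT).
move=> /nbhs_ballP[[d d']]; rewrite /= ltcE /= => /andP[/eqP-> d0] H'.
exists d => // w wd; have := H' w.
rewrite /ball /= -normrN opprB normCE ltcE /= eqxx /= => /(_ wd).
by rewrite -normrN opprB normCE ltcE /= eqxx.
Qed.

End Modulus.

(** * Taylor estimates for the complex exponential *)

Section Exponential.
Variable R : realType.
Implicit Types (z w h : R[i]).

Lemma cabs_cexp z : cabs (cexp z) = expR (complex.Re z).
Proof.
case: z => a b; rewrite /cabs /cexp /= !exprMn -mulrDr cos2Dsin2 mulr1.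
by rewrite sqrtr_sqr ger0_norm// expR_ge0.
Qed.

Lemma cexpD z w : cexp (z + w) = cexp z * cexp w.
Proof.
case: z w => a b [c d] /=; rewrite expRD cosD sinD.
by congr Complex => /=; ring.
Qed.

(** This bound and the next rest on [1 + y <= expR y] at [y = x] and [y = - x]; multiplied by
    [expR x], the latter reads [expR x * (1 - x) <= 1]. *)
Lemma expRB1_le (x : R) : `|expR x - 1| <= `|x| * expR `|x|.
Proof.
have h1 := expR_ge1Dx x; have h2 := expR_ge1Dx (- x).
have e0 := expR_gt0 x.
have [x0|x0] := leP 0 x.
  have e1 : 1 <= expR x by lra.
  rewrite ger0_norm ?subr_ge0// (ger0_norm x0).
  have : expR x * (1 + - x) <= expR x * expR (- x) by rewrite ler_wpM2l// ltW.
  by rewrite expRxMexpNx_1; lra.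
have e1 : expR x <= 1 by rewrite expR_le1 ltW.
rewrite ler0_norm ?subr_le0// (ltr0_norm x0).
have : - x * 1 <= - x * expR (- x) by rewrite ler_wpM2l; lra.
by lra.
Qed.

Lemma expRB1B_le (x : R) : `|expR x - 1 - x| <= x ^+ 2 * expR `|x|.
Proof.
have h1 := expR_ge1Dx x; have h2 := expR_ge1Dx (- x).
have e0 := expR_gt0 x.
rewrite ger0_norm; last by lra.
have : expR x * (1 + - x) <= expR x * expR (- x) by rewrite ler_wpM2l// ltW.
rewrite expRxMexpNx_1 => h3.
apply: (@le_trans _ _ (x * (expR x - 1))); first by lra.
apply: le_trans (ler_norm _) _; rewrite normrM.
rewrite -(real_normK (num_real x)) expr2 -mulrA ler_wpM2l//.
exact: expRB1_le.
Qed.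

(** The mean value theorem based at 0, for either sign of [x]. The bound on [c] lets one estimate
    feed the next, as [cosB1_le] feeds [sinB_le]. *)
Lemma MVT0 (f df : R -> R) (x : R) : (forall y : R, is_derive y 1 f (df y)) ->
  exists2 c, `|c| <= `|x| & f x - f 0 = df c * x.
Proof.
move=> H; have cf : continuous f.
  by move=> y; apply/differentiable_continuous/derivable1_diffP; have [] := H y.
have [x0|x0|<-] := ltgtP 0 x.
- have [c] := MVT x0 (fun y _ => H y) (continuous_subspaceT cf).
  rewrite in_itv /= subr0 => /andP[c0 cx] E; exists c => //.
  by rewrite !gtr0_norm// ltW.
- have [c] := MVT x0 (fun y _ => H y) (continuous_subspaceT cf).
  rewrite in_itv /= sub0r mulrN => /andP[c0 cx] E; exists c.
    by rewrite !ltr0_norm// lerN2 ltW.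
  by rewrite -opprB E opprK.
- by exists 0 => //; rewrite subrr mulr0.
Qed.

Lemma cosB1_le (x : R) : `|cos x - 1| <= `|x|.
Proof.
have [c _] := @MVT0 (cos : R -> R) (fun y => - sin y) x (@is_derive_cos R).
by rewrite cos0 => ->; rewrite normrM normrN ler_piMl// sin_max.
Qed.

Lemma sinB_le (x : R) : `|sin x - x| <= x ^+ 2.
Proof.
have [c cx] := @MVT0 (fun y => sin y - y) (fun y => cos y - 1) x
  (fun y => is_deriveB (is_derive_sin y) (is_derive_id y 1)).
rewrite sin0 !subr0 => ->; rewrite normrM -(real_normK (num_real x)) expr2.
by rewrite ler_wpM2r// (le_trans (cosB1_le _)).
Qed.

Lemma cosB1_le2 (x : R) : `|cos x - 1| <= x ^+ 2.
Proof.
have [c cx] := @MVT0 (cos : R -> R) (fun y => - sin y) x (@is_derive_cos R).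
rewrite cos0 => ->; rewrite normrM normrN -(real_normK (num_real x)) expr2.
have [d _] := @MVT0 (sin : R -> R) cos c (@is_derive_sin R).
rewrite sin0 subr0 => ->; rewrite ler_wpM2r// normrM (le_trans _ cx)// ler_piMl//.
by rewrite ler_norml cos_geN1 cos_le1.
Qed.

(** With [z = a + i b], the real part splits into the remainder of [expR a] plus
    [expR a * (cos b - 1)], and the imaginary part into [expR a * (sin b - b)] plus
    [(expR a - 1) * b]; each piece is quadratic in [a] and [b], up to the factor [expR |a|]. *)
Lemma cexp_taylor z :
  cabs (cexp z - 1 - z) <= 4 * cabs z ^+ 2 * expR `|complex.Re z|.
Proof.
apply: (le_trans (cabs_le_ReIm _)); rewrite cabs2.
case: z => a b /=; rewrite subr0.
have eE : expR a <= expR `|a| by rewrite ler_expR ler_norm.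
have e1 : 1 <= expR `|a| by rewrite -expR0 ler_expR.
have h1 : `|expR a * cos b - 1 - a| <= (a ^+ 2 + b ^+ 2) * expR `|a|.
  have -> : expR a * cos b - 1 - a = (expR a - 1 - a) + expR a * (cos b - 1) by ring.
  rewrite (le_trans (ler_normD _ _))// mulrDl lerD ?expRB1B_le//.
  rewrite normrM (ger0_norm (expR_ge0 _)) mulrC ler_pM ?expR_ge0//.
  exact: cosB1_le2.
have h2 : `|expR a * sin b - b| <= b ^+ 2 * expR `|a| + `|a| * `|b| * expR `|a|.
  have -> : expR a * sin b - b = expR a * (sin b - b) + (expR a - 1) * b by ring.
  rewrite (le_trans (ler_normD _ _))// !normrM (ger0_norm (expR_ge0 _)) lerD//.
    by rewrite mulrC ler_pM ?expR_ge0// sinB_le.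
  by rewrite mulrAC ler_wpM2r// expRB1_le.
have h3 : `|a| * `|b| <= a ^+ 2 + b ^+ 2.
  rewrite -(real_normK (num_real a)) -(real_normK (num_real b)).
  have := sqr_ge0 (`|a| - `|b|); rewrite sqrrB.
  have := mulr_ge0 (normr_ge0 a) (normr_ge0 b); lra.
have a2 := sqr_ge0 a; have b2 := sqr_ge0 b.
apply: (le_trans (lerD h1 h2)).
rewrite -!mulrDl ler_wpM2r ?expR_ge0//; lra.
Qed.

End Exponential.

(** * Measurability and sigma-finiteness *)

Section PlaneMeasurability.
Variable R : realType.

(** An open set is the union of the countably many rational open rectangles it contains; the other
    rectangles are replaced by [set0]. *)
Lemma open_prod_measurable (A : set (R * R)) : open A -> measurable A.
Proof.
move=> oA; pose rect (q : rat * rat * (rat * rat)) : set (R * R) :=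
  (`]ratr q.1.1, ratr q.1.2[ `*` `]ratr q.2.1, ratr q.2.2[)%classic.
have -> : A = (\bigcup_q (if `[< rect q `<=` A >] then rect q else set0))%classic.
  apply/seteqP; split => [p Ap|p [q _]]; last by case: asboolP => // qA /qA.
  have /nbhs_ballP[e /= e0 He] : nbhs p A by exact: open_nbhs_nbhs.
  have q1 (x : R) : exists q : rat * rat, (x - e < ratr q.1 < x) && (x < ratr q.2 < x + e).
    have [a] : exists a, ratr a \in `]x - e, x[ by apply: rat_in_itvoo; rewrite ltrBlDr ltrDl.
    have [b] : exists b, ratr b \in `]x, x + e[ by apply: rat_in_itvoo; rewrite ltrDl.
    by rewrite !in_itv /= => hb ha; exists (a, b); rewrite /= ha hb.
  have [[a b] /= /andP[/andP[a1 a2] /andP[b1 b2]]] := q1 p.1.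
  have [[c d] /= /andP[/andP[c1 c2] /andP[d1 d2]]] := q1 p.2.
  exists ((a, b), (c, d)) => //; case: asboolP => [_|[]].
    by rewrite /rect /= !in_itv /= a2 b1 c2 d1.
  move=> [x y]; rewrite /rect /= !in_itv /= => -[/andP[ax xb] /andP[cy yd]].
  apply: He; split; rewrite /ball /= ltr_norml; apply/andP; split; lra.
apply: countable_bigcupT_measurable => // q; case: asboolP => // _.
by apply: measurableX; exact: measurable_itv.
Qed.

Lemma continuous_prod_measurable (g : R * R -> R) :
  continuous g -> measurable_fun setT g.
Proof.
move=> /continuousP cg; apply: (measurability _ (RGenOpens.measurableE R)).
move=> _ [_ [a [b ->] <-]]; rewrite setTI; apply: open_prod_measurable.
exact/cg/interval_open.
Qed.

Lemma entire_measurable_toC (f : R[i] -> R[i]) : entire f ->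
  measurable_fun setT (fun w : R * R => complex.Re (f (toC w))) /\
  measurable_fun setT (fun w : R * R => complex.Im (f (toC w))).
Proof.
move=> ef.
have H (g : R[i] -> R) : (forall z, `|g z| <= cabs z) -> (forall z w, g (z - w) = g z - g w) ->
    measurable_fun setT (fun w : R * R => g (f (toC w))).
  move=> gle gB; apply: continuous_prod_measurable => p; apply/cvgrPdist_lt => e e0.
  have [d d0 Hd] := entire_continuous (toC p) ef e0.
  (* Balls of [R * R] are squares, and the modulus is at most the sum of the two coordinates, hence
     [d / 2]. *)
  have d2 : 0 < d / 2 by rewrite divr_gt0.
  suff : nbhs p [set q | `|g (f (toC p)) - g (f (toC q))| < e]%classic by [].
  apply/nbhs_ballP; exists (d / 2) => //.
  move=> q [/=]; rewrite /ball /= => q1 q2.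
  rewrite distrC -gB (le_lt_trans (gle _))// Hd// (le_lt_trans (cabs_le_ReIm _))//=.
  by rewrite distrC (distrC q.2); lra.
split; apply: H => [z|[a b] [c e]] //; [exact: Re_le_cabs|exact: Im_le_cabs].
Qed.

End PlaneMeasurability.

Section SigmaFinite.
Context d (T : measurableType d) (R : realType).
Variable mu : {measure set T -> \bar R}.

(** The superlevel sets of [f] at heights [1 / (n + 1)] exhaust the space and have finite measure by
    Markov's inequality. *)
Lemma integrable_gt0_sigma_finite (f : T -> R) : measurable_fun setT f ->
  (forall x, 0 < f x) -> (\int[mu]_x (f x)%:E < +oo)%E -> sigma_finite setT mu.
Proof.
move=> mf f0 foo; pose F n := [set x | n.+1%:R^-1 <= f x]%classic.
have mF n : measurable (F n).
  rewrite -[F n]setTI.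
  by apply: measurable_fun_le => //; exact: measurable_cst.
exists F.
  apply/esym/seteqP; split => // x _.
  by have [n /ltW nf] := ltr_add_invr (f0 x); exists n => //; move: nf; rewrite add0r.
move=> n; split => //.
have n0 : 0 < n.+1%:R :> R by rewrite ltr0n.
have : (\int[mu]_x (n.+1%:R^-1 * \1_(F n) x)%:E < +oo)%E.
  apply: le_lt_trans foo; apply: ge0_le_integral => //.
  - by apply/measurable_EFinP; apply: measurable_funM => //; exact: measurable_indic.
  - exact/measurable_EFinP.
  - move=> x _; rewrite lee_fin indicE; case: (boolP (x \in F n)) => [/set_mem|_] /=.
      by rewrite mulr1.
    by rewrite mulr0 ltW.
under eq_integral do rewrite EFinM.
rewrite ge0_integralZl_EFin//; last first.
  by apply/measurable_EFinP; exact: measurable_indic.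
rewrite integral_indic// setIT => Fn.
rewrite ltey; apply/eqP => E; move: Fn; rewrite E mulry gtr0_sg ?invr_gt0//.
by rewrite mul1e ltxx.
Qed.

End SigmaFinite.

Section SigmaFiniteOf.
Context d (T : measurableType d) (R : realType) (mu : {measure set T -> \bar R}).

(** A copy of [mu] indexed by a proof of sigma-finiteness, so that structure inference finds this
    proof when Tonelli's theorem is applied. *)
Definition sigma_finite_of & sigma_finite setT mu : set T -> \bar R := mu.

Context (sf : sigma_finite setT mu).

HB.instance Definition _ := Measure.copy (sigma_finite_of sf) mu.

HB.instance Definition _ :=
  Measure_isSigmaFinite.Build _ _ _ (sigma_finite_of sf) sf.

End SigmaFiniteOf.

(** * Gaussian averages of a measure *)

Section NormalConvolution.
Variable R : realType.

(* For this standard deviation the density is proportional to [expR (- (a * v ^+ 2))]. *)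
Lemma normal_convolution (a : R) : 0 < a -> exists2 c : R, 0 < c & forall u : R,
  (\int[lebesgue_measure]_v
     (normal_pdf 0 (Num.sqrt (2 * a)^-1) v * expR (- (a * (u - v) ^+ 2)))%:E
   = (c * expR (- (a / 2 * u ^+ 2)))%:E)%E.
Proof.
move=> a0; set s := Num.sqrt _; pose s' := Num.sqrt (4 * a)^-1 : R.
have a2 : 0 < (2 * a)^-1 by rewrite invr_gt0 mulr_gt0.
have a4 : 0 < (4 * a)^-1 by rewrite invr_gt0 mulr_gt0.
have s0 : s != 0 by rewrite gt_eqF// sqrtr_gt0.
have s'0 : s' != 0 by rewrite gt_eqF// sqrtr_gt0.
have ss : s ^+ 2 = (2 * a)^-1 by rewrite sqr_sqrtr// ltW.
have ss' : s' ^+ 2 = (4 * a)^-1 by rewrite sqr_sqrtr// ltW.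
have c0 : 0 < normal_peak s / normal_peak s' by rewrite divr_gt0// normal_peak_gt0.
exists (normal_peak s / normal_peak s') => // u.
(* By [a v^2 + a (u - v)^2 = a u^2 / 2 + 2 a (v - u / 2)^2], the product is a Gaussian in [v] of
   mean [u / 2] and variance [1 / (4 a)], times a factor depending on [u] only. *)
have E v : normal_pdf 0 s v * expR (- (a * (u - v) ^+ 2)) =
    normal_peak s / normal_peak s' * expR (- (a / 2 * u ^+ 2)) * normal_pdf (u / 2) s' v.
  rewrite !normal_pdfE// /normal_fun ss ss'.
  rewrite -[LHS]mulrA -[in LHS]expRD.
  rewrite [RHS](_ : _ = normal_peak s * (expR (- (a / 2 * u ^+ 2)) *
     expR (- (v - u / 2) ^+ 2 / ((4 * a)^-1 *+ 2)))); last first.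
    by field; rewrite gt_eqF// normal_peak_gt0.
  rewrite -expRD; congr (_ * expR _).
  by field; rewrite gt_eqF.
under eq_integral do rewrite E EFinM.
rewrite ge0_integralZl_EFin//.
- by rewrite integral_normal_pdf mule1.
- by move=> v _; rewrite lee_fin normal_pdf_ge0.
- by apply/measurable_EFinP; exact: measurable_normal_pdf.
- by rewrite mulr_ge0 ?expR_ge0// ltW.
Qed.

End NormalConvolution.

Section GaussianSmoothing.
Context d (T : measurableType d) (R : realType).
Variable mu : {sigma_finite_measure set T -> \bar R}.

(* Meant for [p] a coordinate of the plane and [g] the Gaussian in the other one. *)
Lemma gaussian_smoothing (a : R) : 0 < a -> exists2 c : R, 0 < c &
  forall (p g : T -> R) (C : R), measurable_fun setT p -> measurable_fun setT g ->
  (forall w, 0 <= g w) ->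
  (forall t : R, (\int[mu]_w (expR (- (a * (t - p w) ^+ 2)) * g w)%:E <= C%:E)%E) ->
  forall t : R, (\int[mu]_w (expR (- (a / 2 * (t - p w) ^+ 2)) * g w)%:E <= (C / c)%:E)%E.
Proof.
move=> a0; have [c c0 Hc] := normal_convolution a0; exists c => // p g C mp mg g0 H t.
set s := Num.sqrt _ in Hc.
(* Integrating [F] in [v] first gives [c] times the wider Gaussian, by [normal_convolution].
   Integrating in [w] first gives at most [C] times the density, by the hypothesis at [t - v], and
   the density has mass 1. *)
pose F (x : T * R) : \bar R :=
  (normal_pdf 0 s x.2 * expR (- (a * (t - p x.1 - x.2) ^+ 2)) * g x.1)%:E.
have mF : measurable_fun setT F.
  apply/measurable_EFinP; apply: measurable_funM; last exact: measurableT_comp.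
  apply: measurable_funM; first exact: (measurableT_comp (measurable_normal_pdf _ _)).
  apply: measurableT_comp; first exact: measurable_expR.
  apply: measurableT_comp => //; apply: measurable_funM => //.
  apply: measurable_funX; apply: measurable_funB => //.
  by apply: measurable_funB => //; exact: measurableT_comp.
have F0 x : (0 <= F x)%E by rewrite lee_fin !mulr_ge0 ?expR_ge0 ?normal_pdf_ge0.
have mN : measurable_fun setT (fun v => (normal_pdf 0 s v)%:E).
  by apply/measurable_EFinP; exact: measurable_normal_pdf.
have E1 : (c%:E * \int[mu]_w (expR (- (a / 2 * (t - p w) ^+ 2)) * g w)%:E =
    \int[mu]_w \int[lebesgue_measure]_v F (w, v))%E.
  rewrite -ge0_integralZl_EFin//; last 3 first.
  - by move=> w _; rewrite lee_fin mulr_ge0 ?expR_ge0.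
  - apply/measurable_EFinP; apply: measurable_funM => //.
    apply: measurableT_comp; first exact: measurable_expR.
    apply: measurableT_comp => //; apply: measurable_funM => //.
    by apply: measurable_funX; apply: measurable_funB.
  - exact: ltW.
  apply: eq_integral => w _; rewrite -EFinM mulrA EFinM -Hc muleC.
  rewrite -ge0_integralZl_EFin//; last 2 first.
  - by move=> v _; rewrite lee_fin mulr_ge0 ?expR_ge0 ?normal_pdf_ge0.
  - apply/measurable_EFinP; apply: measurable_funM; first exact: measurable_normal_pdf.
    apply: measurableT_comp; first exact: measurable_expR.
    apply: measurableT_comp => //; apply: measurable_funM => //.
    by apply: measurable_funX; apply: measurable_funB.
  by apply: eq_integral => v _; rewrite -EFinM /F /= mulrC.
suff : (c%:E * \int[mu]_w (expR (- (a / 2 * (t - p w) ^+ 2)) * g w)%:E <= C%:E)%E.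
  by rewrite EFinM lee_pdivlMr// muleC.
rewrite E1 fubini_tonelli//.
have -> : (C%:E = \int[lebesgue_measure]_v (C%:E * (normal_pdf 0 s v)%:E))%E.
  rewrite ge0_integralZl_EFin//.
  - by rewrite integral_normal_pdf mule1.
  - by move=> v _; rewrite lee_fin normal_pdf_ge0.
  - rewrite -lee_fin; apply: le_trans (H 0); apply: integral_ge0 => w _.
    by rewrite lee_fin mulr_ge0 ?expR_ge0.
apply: ge0_le_integral => //.
- by move=> v _; apply: integral_ge0.
- exact: (measurable_fun_fubini_tonelli_G F).
- exact: measurable_funeM.
move=> v _; rewrite muleC /F /=.
under eq_integral do rewrite -mulrA EFinM.
rewrite ge0_integralZl_EFin ?normal_pdf_ge0//; last 2 first.
- by move=> w _; rewrite lee_fin mulr_ge0 ?expR_ge0.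
- apply/measurable_EFinP; apply: measurable_funM => //.
  apply: measurableT_comp; first exact: measurable_expR.
  apply: measurableT_comp => //; apply: measurable_funM => //.
  by apply: measurable_funX; apply: measurable_funB => //; apply: measurable_funB.
apply: lee_wpmul2l; rewrite ?lee_fin ?normal_pdf_ge0//.
under eq_integral do rewrite addrAC; exact: H.
Qed.

End GaussianSmoothing.

(** * From almost everywhere bounds to pointwise bounds *)

Section Heat.
Variable R : realType.

Definition gauss (b : R) (z w : R * R) : R :=
  expR (- (b * sqn (z.1 - w.1, z.2 - w.2))).

Lemma gauss_ge0 b z w : 0 <= gauss b z w. Proof. exact: expR_ge0. Qed.

Lemma measurable_gauss2 b : measurable_fun setT (fun x : (R * R) * (R * R) => gauss b x.1 x.2).
Proof.
apply: measurableT_comp; first exact: measurable_expR.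
apply: measurableT_comp => //; apply: measurable_funM => //.
have m11 : measurable_fun setT (fun x : (R * R) * (R * R) => x.1.1) by exact: measurableT_comp.
have m12 : measurable_fun setT (fun x : (R * R) * (R * R) => x.1.2) by exact: measurableT_comp.
have m21 : measurable_fun setT (fun x : (R * R) * (R * R) => x.2.1) by exact: measurableT_comp.
have m22 : measurable_fun setT (fun x : (R * R) * (R * R) => x.2.2) by exact: measurableT_comp.
by apply: measurable_funD; apply: measurable_funX; apply: measurable_funB.
Qed.

Lemma measurable_gauss b z : measurable_fun setT (gauss b z).
Proof.
apply: (measurableT_comp (measurable_gauss2 b) (g := fun w => (z, w))).
exact: pair1_measurable.
Qed.

Definition heat (mu : {measure set (R * R)%type -> \bar R}) (b : R) (z : R * R) : \bar R :=
  (\int[mu]_w (gauss b z w)%:E)%E.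

Lemma heat_ge0 mu b z : (0 <= heat mu b z)%E.
Proof. by apply: integral_ge0 => w _; rewrite lee_fin gauss_ge0. Qed.

(** The index [j] may vary with [w]: the sum over all four indices dominates every choice, so no
    measurable selection is involved. A pair of booleans encodes one binary choice per
    coordinate. *)
Lemma integral_le_heat (mu : {measure set (R * R)%type -> \bar R}) (b K C : R)
    (p : bool * bool -> R * R) (g : R * R -> R) :
  0 <= K -> measurable_fun setT g -> (forall w, 0 <= g w) ->
  (forall w, exists j, g w <= K * gauss b (p j) w) ->
  (forall j, (heat mu b (p j) <= C%:E)%E) ->
  (\int[mu]_w (g w)%:E <= (4 * (K * C))%:E)%E.
Proof.
move=> K0 mg g0 gK HC.
have mG j : measurable_fun setT (fun w => (K * gauss b (p j) w)%:E).
  by apply/measurable_EFinP; apply: measurable_funM => //; exact: measurable_gauss.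
have G0 j w : (0 <= (K * gauss b (p j) w)%:E)%E by rewrite lee_fin mulr_ge0 ?gauss_ge0.
apply: (@le_trans _ _ (\int[mu]_w (\sum_(j : bool * bool) (K * gauss b (p j) w)%:E)%E)%E).
  apply: ge0_le_integral => //.
  - by move=> w _; rewrite lee_fin.
  - by apply/measurable_EFinP.
  - exact: emeasurable_sum.
  move=> w _; have [j] := gK w; rewrite -lee_fin => /le_trans; apply.
  by rewrite (bigD1 j)//= leeDl// sume_ge0.
rewrite ge0_integral_sum//.
apply: (@le_trans _ _ (\sum_(j : bool * bool) (K * C)%:E)%E).
  apply: lee_sum => j _; under eq_integral do rewrite EFinM.
  rewrite ge0_integralZl_EFin//; last 2 first.
  - by move=> w _; rewrite lee_fin gauss_ge0.
  - by apply/measurable_EFinP; exact: measurable_gauss.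
  by rewrite EFinM; apply: lee_wpmul2l; rewrite ?lee_fin// HC.
rewrite sumEFin lee_fin sumr_const card_prod card_bool -[leLHS]mulr_natl.
by [].
Qed.

(** An open unit square has area 1, so a null set cannot contain it. *)
Lemma ae_unit_square (P : R * R -> Prop) (a b : R) :
  {ae (@lebesgue_measure R \x @lebesgue_measure R)%E, forall z, P z} ->
  exists2 z, P z & a < z.1 < a + 1 /\ b < z.2 < b + 1.
Proof.
move=> [N [mN N0 PN]]; apply: contrapT => H.
pose I (x : R) : set R := (`]x, x + 1[)%classic.
have mI x : measurable (I x) by exact: measurable_itv.
have l1 (x : R) : lebesgue_measure (I x) = 1%E.
  by rewrite lebesgue_measure_itv /= lte_fin ltrDl ltr01 -EFinB addrAC subrr add0r.
have IN : (I a `*` I b `<=` N)%classic.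
  move=> z; rewrite /I /= !in_itv /= => zQ; apply: PN => Pz; apply: H.
  by exists z.
have : ((@lebesgue_measure R \x @lebesgue_measure R) (I a `*` I b)%classic <= 0)%E.
  rewrite -N0; apply: le_measure => //; rewrite inE//.
  exact: (measurableX (mI a) (mI b)).
have -> : ((@lebesgue_measure R \x @lebesgue_measure R) (I a `*` I b)%classic =
    lebesgue_measure (I a) * lebesgue_measure (I b))%E.
  by apply: product_measure1E; exact: mI.
by rewrite !l1 mule1 lee_fin ler10.
Qed.

Lemma heat_bounded (mu : {measure set (R * R)%type -> \bar R}) (b M : R) : 0 < b ->
  {ae (@lebesgue_measure R \x @lebesgue_measure R)%E, forall z, (heat mu b z <= M%:E)%E} ->
  forall z, (heat mu b z <= (4 * (expR (b * 2) * M))%:E)%E.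
Proof.
move=> b0 H z.
pose corner (s : bool) (x : R) := if s then x else x - 1.
have /choice[p Hp] : forall j : bool * bool, exists q, (heat mu b q <= M%:E)%E /\
    (corner j.1 z.1 < q.1 < corner j.1 z.1 + 1 /\ corner j.2 z.2 < q.2 < corner j.2 z.2 + 1).
  by move=> j; have [q ? ?] := ae_unit_square (corner j.1 z.1) (corner j.2 z.2) H; exists q.
(* For one of the two corners [q - x] and [x - t] have opposite signs, whence
   [(q - t) ^+ 2 <= (x - t) ^+ 2 + (q - x) ^+ 2]. *)
have closer (x t : R) : exists s, forall q, corner s x < q < corner s x + 1 ->
    (q - t) ^+ 2 <= (x - t) ^+ 2 + 1.
  have [xt|xt] := leP x t; [exists true|exists false] => q /= /andP[q1 q2].
    have : (q - x) * (x - t) <= 0 by rewrite mulr_ge0_le0; lra.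
    have : (q - x) * (q - x) <= 1 * 1 by rewrite ler_pM; lra.
    by lra.
  have : (x - q) * (x - t) >= 0 by rewrite mulr_ge0; lra.
  have : (x - q) * (x - q) <= 1 * 1 by rewrite ler_pM; lra.
  by lra.
(* The nearer generic point adds at most 1 to the squared distance in each coordinate, which costs
   the factor [expR (b * 2)]. *)
apply: (@integral_le_heat _ _ _ _ p).
- exact: expR_ge0.
- exact: measurable_gauss.
- by move=> w; exact: gauss_ge0.
- move=> w; have [s Hs] := closer z.1 w.1; have [t Ht] := closer z.2 w.2.
  exists (s, t); rewrite /gauss -expRD ler_expR /sqn /=.
  have [_ [/Hs h1 /Ht h2]] := Hp (s, t).
  have aux (x y x' y' : R) : x' <= x + 1 -> y' <= y + 1 ->
      - (b * (x + y)) <= b * 2 + - (b * (x' + y')).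
    by move=> hx hy; rewrite -mulrN -[leRHS]mulrBr ler_wpM2l ?(ltW b0)//; lra.
  exact: aux.
- by move=> j; have [] := Hp j.
Qed.

End Heat.

(** * Complex-valued integrals *)

Section ComplexIntegral.
Local Open Scope complex_scope.
Context d (T : measurableType d) (R : realType).
Variable mu : {measure set T -> \bar R}.
Implicit Types F G : T -> R[i].

Definition cmeasurable F :=
  measurable_fun setT (fun w => complex.Re (F w)) /\
  measurable_fun setT (fun w => complex.Im (F w)).

(** On [toep_integrand] this and [cint] are convertible to [toep_defined] and [toeplitz], so the
    lemmas below apply to the operator directly. *)
Definition cintegrable F :=
  mu.-integrable setT (fun w => (complex.Re (F w))%:E) /\
  mu.-integrable setT (fun w => (complex.Im (F w))%:E).

Definition cint F : R[i] :=
  (\int[mu]_w complex.Re (F w))%R +i* (\int[mu]_w complex.Im (F w))%R.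

Lemma ReM (x y : R[i]) :
  complex.Re (x * y) = complex.Re x * complex.Re y - complex.Im x * complex.Im y.
Proof. by case: x y => [a b] []. Qed.

Lemma ImM (x y : R[i]) :
  complex.Im (x * y) = complex.Re x * complex.Im y + complex.Im x * complex.Re y.
Proof. by case: x y => [a b] []. Qed.

Lemma cmeasurableM F G : cmeasurable F -> cmeasurable G ->
  cmeasurable (fun w => F w * G w).
Proof.
move=> [F1 F2] [G1 G2]; split.
  under eq_fun do rewrite ReM.
  by apply: measurable_funB; apply: measurable_funM.
under eq_fun do rewrite ImM.
by apply: measurable_funD; apply: measurable_funM.
Qed.

Lemma cmeasurable_conj F : cmeasurable F -> cmeasurable (fun w => (F w)^*).
Proof.
move=> [F1 F2]; split.
  by have -> : (fun w => complex.Re (F w)^*) = (fun w => complex.Re (F w));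
    first by apply/funext => w; case: (F w).
have -> : (fun w => complex.Im (F w)^*) = (fun w => - complex.Im (F w)).
  by apply/funext => w; case: (F w).
exact: measurableT_comp.
Qed.

Lemma le_cintegrable F (g : T -> R) : cmeasurable F ->
  mu.-integrable setT (EFin \o g) -> (forall w, cabs (F w) <= g w) -> cintegrable F.
Proof.
move=> [F1 F2] ig Fg; split; apply: le_integrable ig => //.
- exact/measurable_EFinP.
- by move=> w _; rewrite lee_fin (le_trans (Re_le_cabs _))// (le_trans (Fg w))// ler_norm.
- exact/measurable_EFinP.
- by move=> w _; rewrite lee_fin (le_trans (Im_le_cabs _))// (le_trans (Fg w))// ler_norm.
Qed.

(** The factor 2 comes from bounding the real and imaginary parts separately; some constant is all
    that boundedness asks for. *)
Lemma cabs_cint_le F (g : T -> R) : cintegrable F ->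
  mu.-integrable setT (EFin \o g) -> (forall w, cabs (F w) <= g w) ->
  cabs (cint F) <= 2 * (\int[mu]_w g w)%R.
Proof.
move=> [F1 F2] ig Fg; apply: (le_trans (cabs_le_ReIm _)) => /=.
have H (f : T -> R) : mu.-integrable setT (EFin \o f) -> (forall w, `|f w| <= g w) ->
    `|(\int[mu]_w f w)%R| <= (\int[mu]_w g w)%R.
  move=> fi fg; apply: (le_trans (le_normr_Rintegral measurableT fi)).
  apply: le_Rintegral => //; exact: integrable_norm fi.
rewrite mulr_natl mulr2n; apply: lerD; apply: H => // w.
  exact: le_trans (Re_le_cabs _) (Fg w).
exact: le_trans (Im_le_cabs _) (Fg w).
Qed.

Lemma cintegrableB F G : cintegrable F -> cintegrable G ->
  cintegrable (fun w => F w - G w).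
Proof.
move=> [F1 F2] [G1 G2]; split.
  rewrite (_ : (fun _ => _) = (fun w => (complex.Re (F w))%:E - (complex.Re (G w))%:E)%E).
    exact: integrableB.
  by apply/funext => w; case: (F w) (G w) => [a b] [].
rewrite (_ : (fun _ => _) = (fun w => (complex.Im (F w))%:E - (complex.Im (G w))%:E)%E).
  exact: integrableB.
by apply/funext => w; case: (F w) (G w) => [a b] [].
Qed.

Lemma cintB F G : cintegrable F -> cintegrable G ->
  cint (fun w => F w - G w) = cint F - cint G.
Proof.
move=> [F1 F2] [G1 G2]; rewrite /cint; congr Complex.
  rewrite -RintegralB//; apply: eq_Rintegral => w _.
  by case: (F w) (G w) => [a b] [].
rewrite -RintegralB//; apply: eq_Rintegral => w _.
by case: (F w) (G w) => [a b] [].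
Qed.

Lemma cintegrableZ c F : cintegrable F -> cintegrable (fun w => c * F w).
Proof.
move=> [F1 F2]; split.
  rewrite (_ : (fun _ => _) = (fun w => (complex.Re c)%:E * (complex.Re (F w))%:E -
                             (complex.Im c)%:E * (complex.Im (F w))%:E)%E).
    by apply: integrableB => //; exact: integrableZl.
  by apply/funext => w; rewrite ReM.
rewrite (_ : (fun _ => _) = (fun w => (complex.Re c)%:E * (complex.Im (F w))%:E +
                           (complex.Im c)%:E * (complex.Re (F w))%:E)%E).
  by apply: integrableD => //; exact: integrableZl.
by apply/funext => w; rewrite ImM.
Qed.

Lemma cintZ c F : cintegrable F -> cint (fun w => c * F w) = c * cint F.
Proof.
move=> [F1 F2]; have H r f : mu.-integrable setT (EFin \o f) ->
    mu.-integrable setT (EFin \o (fun w => r * f w)).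
  by move=> fi; apply: (integrableZl measurableT r fi).
case: c => a b; rewrite /cint /=; congr Complex.
  rewrite -!RintegralZl// -RintegralB//; [|exact: H..].
  by apply: eq_Rintegral => w _; rewrite ReM.
rewrite -!RintegralZl// -RintegralD//; [|exact: H..].
by apply: eq_Rintegral => w _; rewrite ImM.
Qed.

End ComplexIntegral.

(** * Toeplitz operators *)

Section ToeplitzIntegrand.
Local Open Scope complex_scope.
Variable R : realType.
Implicit Types (z w h : R[i]) (f : R[i] -> R[i]).

Lemma cabs_conj z : cabs (conjc z) = cabs z.
Proof. by case: z => a b; rewrite /cabs /= sqrrN. Qed.

Lemma cabs_real (r : R) : cabs (r +i* 0) = `|r|.
Proof. by rewrite /cabs /= expr0n /= addr0 sqrtr_sqr. Qed.

Lemma cexp_conj z : cexp (conjc z) = conjc (cexp z).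
Proof. by case: z => a b; rewrite /cexp /= cosN sinN mulrN. Qed.

Lemma conjcM z w : conjc (z * w) = conjc z * conjc w.
Proof. exact: rmorphM. Qed.

Lemma conj_scaleM (a : R) z w : conjc ((a +i* 0) * (conjc z * w)) = z * ((a +i* 0) * conjc w).
Proof. by case: z w => [x y] [u v] /=; congr Complex; ring. Qed.

Lemma conjcD z w : conjc (z + w) = conjc z + conjc w.
Proof. exact: rmorphD. Qed.

Lemma KernE alpha z w : Kern alpha z w = cexp ((alpha +i* 0) * (conjc z * w)).
Proof. by []. Qed.

Lemma toep_integrandE alpha f z (w : R * R) : toep_integrand alpha f z w =
  f (toC w) * conjc (Kern alpha z (toC w)) * (expR (- (alpha * sqn w)) +i* 0).
Proof. by []. Qed.

Lemma cabs_Kern alpha z w : cabs (Kern alpha z w) =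
  expR (alpha * (complex.Re z * complex.Re w + complex.Im z * complex.Im w)).
Proof.
rewrite !KernE cabs_cexp; case: z w => a b [c d] /=.
by congr expR; ring.
Qed.

(** An increment [h] of the variable multiplies the kernel by [cexp (c * h)], so [cexp_taylor] gives
    the quadratic remainder. *)
Lemma entire_Kern alpha z : entire (Kern alpha z).
Proof.
move=> w; set c := (alpha +i* 0) * conjc z.
apply: (@derivable_quadratic _ _ _ (c * Kern alpha z w)
  (cabs (Kern alpha z w) * (4 * cabs c ^+ 2 * expR (cabs c)))) => h h1.
have -> : Kern alpha z (h + w) - Kern alpha z w - h * (c * Kern alpha z w) =
    Kern alpha z w * (cexp (c * h) - 1 - c * h).
  have -> : Kern alpha z (h + w) = cexp (c * h) * Kern alpha z w.
    by rewrite !KernE -cexpD; congr cexp; rewrite /c; ring.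
  by ring.
rewrite cabsM -[leRHS]mulrA ler_wpM2l ?cabs_ge0//.
apply: (le_trans (cexp_taylor _)).
rewrite cabsM exprMn.
have : expR `|complex.Re (c * h)| <= expR (cabs c).
  rewrite ler_expR (le_trans (Re_le_cabs _))// cabsM ler_piMr ?cabs_ge0//.
move=> H; rewrite [leRHS](_ : _ = 4 * (cabs c ^+ 2 * cabs h ^+ 2) * expR (cabs c)).
  by rewrite ler_wpM2l// mulr_ge0// mulr_ge0// sqr_ge0.
by ring.
Qed.

Definition toR2 z : R * R := (complex.Re z, complex.Im z).

(* In the weighted norm the kernel [Kern alpha z w] completes the square to
   [gauss (alpha / 2) z w]. *)
Lemma cabs_toep_integrand_le alpha f M z (w : R * R) : fock_le alpha f M ->
  cabs (toep_integrand alpha f z w) <=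
  M * expR (alpha / 2 * cabs z ^+ 2) * gauss (alpha / 2) (toR2 z) w.
Proof.
move=> /(_ (toC w)) fM.
rewrite toep_integrandE !cabsM cabs_conj cabs_Kern cabs_real ger0_norm ?expR_ge0//.
move: fM; rewrite !cabs2 /= => fM.
rewrite -mulrA -[leRHS]mulrA.
set E := expR (- _ / 2) in fM.
have -> : expR (alpha * (complex.Re z * w.1 + complex.Im z * w.2)) *
    expR (- (alpha * sqn w)) =
    E * (expR (alpha / 2 * (complex.Re z ^+ 2 + complex.Im z ^+ 2)) *
         gauss (alpha / 2) (toR2 z) w).
  by rewrite /E /gauss -!expRD; congr expR; rewrite /sqn /=; field.
by rewrite mulrA ler_wpM2r// mulr_ge0 ?expR_ge0// gauss_ge0.
Qed.

Lemma cmeasurable_toep_integrand alpha f z : entire f ->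
  cmeasurable (toep_integrand alpha f z).
Proof.
move=> ef; apply: cmeasurableM; first apply: cmeasurableM.
- exact: entire_measurable_toC.
- exact/cmeasurable_conj/entire_measurable_toC/entire_Kern.
- split => /=; last exact: measurable_cst.
  apply: measurableT_comp; first exact: measurable_expR.
  apply: measurableT_comp => //; apply: measurable_funM => //.
  by apply: measurable_funD; apply: measurable_funX.
Qed.

End ToeplitzIntegrand.

(** * Bounded Gaussian averages make the operator bounded *)

Section BoundedHeat.
Local Open Scope complex_scope.
Variables (R : realType) (alpha C : R) (mu : {measure set (R * R)%type -> \bar R}).
Hypothesis alpha0 : 0 < alpha.
Hypothesis heatC : forall z, (heat mu (alpha / 2) z <= C%:E)%E.
Implicit Types (z h : R[i]) (w : R * R) (f : R[i] -> R[i]).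

Let b := alpha / 2.
Let b0 : 0 < b. Proof. by rewrite divr_gt0. Qed.

(** The weight absorbs the growth in [w] of the Taylor remainder in [toeplitz_entire]. With the l1
    norm its exponent is linear on each quadrant, so completing the square applies. *)
Definition gauss_exp (k : R) (z w : R * R) := gauss b z w * expR (k * (`|w.1| + `|w.2|)).

Lemma gauss_exp_integrable k (z : R * R) : 0 <= k -> mu.-integrable setT (EFin \o gauss_exp k z).
Proof.
move=> k0; have mg : measurable_fun setT (gauss_exp k z).
  apply: measurable_funM; first exact: measurable_gauss.
  apply: measurableT_comp; first exact: measurable_expR.
  apply: measurable_funM => //.
  by apply: measurable_funD; apply: measurableT_comp => //; exact: normr_measurable.
apply/integrableP; split; first exact/measurable_EFinP.
pose sg (s : bool) : R := if s then 1 else -1.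
(* Completing the square: [gauss b z w * expR (k * (s * w.1 + t * w.2))], with
   signs [s] and [t], is a multiple of the Gaussian centred at [p (s, t)]. *)
pose p (j : bool * bool) : R * R := (z.1 + sg j.1 * (k / (2 * b)), z.2 + sg j.2 * (k / (2 * b))).
apply: (@le_lt_trans _ _ (\int[mu]_w (gauss_exp k z w)%:E)%E).
  apply: ge0_le_integral => //.
  - by apply/measurable_EFinP; exact: measurableT_comp.
  - by apply/measurable_EFinP.
  - by move=> w _ /=; rewrite lee_fin ger0_norm// mulr_ge0 ?gauss_ge0 ?expR_ge0.
(* In each coordinate, completing the square leaves [k * sg s * z.1], at most [k * |z.1|], and the
   constant [k^2 / (4 b)]. *)
apply: (@le_lt_trans _ _ (4 * (expR (k * (`|z.1| + `|z.2|) + k ^+ 2 / (2 * b)) * C))%:E);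
  last by rewrite ltry.
apply: (@integral_le_heat _ _ b _ _ p) => //.
- by move=> w; rewrite mulr_ge0 ?gauss_ge0 ?expR_ge0.
- move=> w.
  have sgP (x : R) : exists s, `|x| = sg s * x.
    have [x0|x0] := leP 0 x; [exists true|exists false]; rewrite /sg ?mul1r ?mulN1r.
      by rewrite ger0_norm.
    by rewrite ltr0_norm.
  have [s Hs] := sgP w.1; have [t Ht] := sgP w.2; exists (s, t).
  have sg2 r : sg r ^+ 2 = 1 by rewrite /sg; case: r; rewrite ?sqrrN expr1n.
  have sgle r x : sg r * x <= `|x|.
    by rewrite /sg; case: r; rewrite ?mul1r ?mulN1r ?ler_norm// -normrN ler_norm.
  rewrite /gauss_exp /gauss -!expRD ler_expR Hs Ht /p /sqn /=.
  have h1 := ler_wpM2l k0 (lerD (sgle s z.1) (sgle t z.2)).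
  rewrite -subr_ge0.
  rewrite (_ : _ - _ = k * (`|z.1| + `|z.2|) - k * (sg s * z.1 + sg t * z.2)
     + (k ^+ 2 / (4 * b)) * ((1 - sg s ^+ 2) + (1 - sg t ^+ 2))).
    by rewrite !sg2 !subrr addr0 mulr0 addr0 subr_ge0.
  by field; rewrite gt_eqF.
Qed.

Lemma gauss_exp0 (z : R * R) : gauss_exp 0 z = gauss b z.
Proof. by apply/funext => w; rewrite /gauss_exp mul0r expR0 mulr1. Qed.

Lemma toep_definedP f M z : entire f -> fock_le alpha f M -> toep_defined alpha mu f z.
Proof.
move=> ef fM; have ig := gauss_exp_integrable (toR2 z) (lexx 0).
have := integrableZl measurableT (M * expR (alpha / 2 * cabs z ^+ 2)) ig.
rewrite gauss_exp0 => ig'.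
apply: (le_cintegrable (cmeasurable_toep_integrand alpha z ef) ig') => w.
exact: cabs_toep_integrand_le.
Qed.

Lemma toeplitz_fock_le f M : entire f -> fock_le alpha f M ->
  fock_le alpha (toeplitz alpha mu f) (2 * C * M).
Proof.
move=> ef fM z; have ig := gauss_exp_integrable (toR2 z) (lexx 0).
rewrite gauss_exp0 in ig.
have M0 : 0 <= M by apply: le_trans (fM z); rewrite mulr_ge0 ?cabs_ge0 ?expR_ge0.
have ig' := integrableZl measurableT (M * expR (alpha / 2 * cabs z ^+ 2)) ig.
have := cabs_cint_le (toep_definedP z ef fM) ig'
  (fun w => cabs_toep_integrand_le z w fM).
rewrite RintegralZl// => H.
have H2 : (\int[mu]_w gauss (alpha / 2) (toR2 z) w)%R <= C.
  rewrite -lee_fin fineK; first exact: heatC.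
  by apply: integrable_fin_num => //.
rewrite (_ : - (alpha * cabs z ^+ 2) / 2 = - (alpha / 2 * cabs z ^+ 2)); last by field.
rewrite expRN ler_pdivrMr ?expR_gt0//; apply: (le_trans H).
rewrite [leRHS](_ : _ = 2 * (M * expR (alpha / 2 * cabs z ^+ 2) * C)); last by ring.
by rewrite ler_wpM2l// ler_wpM2l// mulr_ge0 ?expR_ge0.
Qed.

(** Moving from [z] to [h + z] multiplies the integrand by [cexp (h * l w)], where [l w] is [alpha]
    times the conjugate of [w]. The derivative is thus the integral of [T z w * l w], and
    [cexp_taylor] bounds the remainder by [cabs h ^+ 2] times an integrable function. *)
Lemma toeplitz_entire f M : entire f -> fock_le alpha f M -> entire (toeplitz alpha mu f).
Proof.
move=> ef fM z.
have M0 : 0 <= M by apply: le_trans (fM z); rewrite mulr_ge0 ?cabs_ge0 ?expR_ge0.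
(* The 2 absorbs the factor [cabs (toC w) ^+ 2] of the remainder, and [alpha] absorbs its
   exponential, as [cabs h <= 1]. *)
pose k := 2 + alpha; have k0 : 0 <= k by rewrite addr_ge0// ltW.
pose T z' w := toep_integrand alpha f z' w.
pose l (w : R * R) := (alpha +i* 0) * conjc (toC w).
pose K := M * expR (alpha / 2 * cabs z ^+ 2).
have K0 : 0 <= K by rewrite mulr_ge0 ?expR_ge0.
have ig := gauss_exp_integrable (toR2 z) k0.
have mT z' : cmeasurable (T z') by exact: cmeasurable_toep_integrand.
have iT z' : cintegrable mu (T z') by exact: (toep_definedP z' ef fM).
have ml : cmeasurable l.
  split => /=; under eq_fun do rewrite ?ReM ?ImM /=.
    by apply: measurable_funB; apply: measurable_funM => //; apply: measurableT_comp.
  by apply: measurable_funD; apply: measurable_funM => //; apply: measurableT_comp.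
have wle (w : R * R) : cabs (toC w) <= `|w.1| + `|w.2| by exact: cabs_le_ReIm.
have wexp (w : R * R) : `|w.1| + `|w.2| <= expR (`|w.1| + `|w.2|).
  by apply: le_trans (expR_ge1Dx _); rewrite lerDr.
have lE w : cabs (l w) = alpha * cabs (toC w).
  by rewrite /l cabsM cabs_conj cabs_real gtr0_norm.
have Tle w : cabs (T z w) <= K * gauss b (toR2 z) w by exact: cabs_toep_integrand_le.
have il : cintegrable mu (fun w => T z w * l w).
  apply: (le_cintegrable (cmeasurableM (mT z) ml) (integrableZl measurableT (K * alpha) ig)) => w.
  rewrite cabsM lE /=.
  apply: (@le_trans _ _ (K * gauss b (toR2 z) w * (alpha * expR (k * (`|w.1| + `|w.2|))))).
    rewrite ler_pM ?cabs_ge0 ?mulr_ge0 ?cabs_ge0 ?(ltW alpha0)//.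
    rewrite ler_wpM2l ?(ltW alpha0)// (le_trans (wle w))//.
    apply: (le_trans (wexp w)); rewrite ler_expR ler_peMl ?addr_ge0// /k.
    by move: alpha0; lra.
  by rewrite /gauss_exp le_eqVlt; apply/orP; left; apply/eqP; ring.
apply: (@derivable_quadratic _ _ _ (cint mu (fun w => T z w * l w))
  (2 * (K * (4 * alpha ^+ 2) * \int[mu]_w gauss_exp k (toR2 z) w)%R)) => h h1.
pose D w := T (h + z) w - T z w - h * (T z w * l w).
have DE w : D w = T z w * (cexp (h * l w) - 1 - h * l w).
  have -> : cexp (h * l w) = conjc (Kern alpha h (toC w)).
    by rewrite !KernE -cexp_conj conj_scaleM.
  have : Kern alpha (h + z) (toC w) = Kern alpha h (toC w) * Kern alpha z (toC w).
    by rewrite !KernE conjcD mulrDl mulrDr cexpD.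
  by rewrite /D /T !toep_integrandE => ->; rewrite conjcM; ring.
have -> : toeplitz alpha mu f (h + z) - toeplitz alpha mu f z -
    h * cint mu (fun w => T z w * l w) = cint mu D.
  rewrite -cintZ// -!cintB//; first exact: cintegrableB.
  exact: cintegrableZ.
have iD : cintegrable mu D.
  by apply: cintegrableB; [exact: cintegrableB|exact: cintegrableZ].
have ig' := integrableZl measurableT (K * (4 * alpha ^+ 2) * cabs h ^+ 2) ig.
have := cabs_cint_le iD ig'; rewrite RintegralZl//.
move=> H; apply: (le_trans (H _)); last first.
  by rewrite le_eqVlt; apply/orP; left; apply/eqP; ring.
move=> w; rewrite DE cabsM.
rewrite [leRHS](_ : _ = K * gauss b (toR2 z) w * (4 * alpha ^+ 2 * cabs h ^+ 2 *
  expR (k * (`|w.1| + `|w.2|)))); last by rewrite /= /gauss_exp; ring.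
rewrite ler_pM ?cabs_ge0//.
apply: (le_trans (cexp_taylor _)).
rewrite cabsM lE.
rewrite [leLHS](_ : _ = 4 * alpha ^+ 2 * cabs h ^+ 2 *
  (cabs (toC w) ^+ 2 * expR `|complex.Re (h * l w)|)); last by ring.
have c0 : 0 <= 4 * alpha ^+ 2 * cabs h ^+ 2.
  by rewrite mulr_ge0 ?sqr_ge0// mulr_ge0 ?sqr_ge0.
apply: ler_wpM2l => //.
have -> : k * (`|w.1| + `|w.2|) =
    2 * (`|w.1| + `|w.2|) + alpha * (`|w.1| + `|w.2|) by rewrite mulrDl.
rewrite expRD ler_pM ?expR_ge0 ?sqr_ge0//.
  by rewrite expRM_natl ler_pXn2r ?nnegrE ?cabs_ge0 ?expR_ge0// (le_trans (wle w)).
rewrite ler_expR (le_trans (Re_le_cabs _))// cabsM lE.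
rewrite (@le_trans _ _ (alpha * cabs (toC w)))//.
  by rewrite ler_piMl// mulr_ge0 ?cabs_ge0 ?(ltW alpha0).
by rewrite ler_wpM2l ?(ltW alpha0).
Qed.

End BoundedHeat.

(** * Testing on kernels and widening the Gaussian *)

Section Berezin.
Local Open Scope complex_scope.
Variables (R : realType) (alpha : R) (mu : {measure set (R * R)%type -> \bar R}).
Hypothesis alpha0 : 0 < alpha.

Lemma mu_tildeE z : mu_tilde alpha 1 mu z = ((alpha / pi)%:E * heat mu (alpha / 2) z)%E.
Proof.
rewrite /mu_tilde /heat; congr (_ * _)%E; apply: eq_integral => w _.
by rewrite /gauss; congr (expR _)%:E; field.
Qed.

(** Completing the square. It turns condition (M) into finiteness of [heat mu alpha], and evaluates
    [toeplitz] of a kernel at its own base point. *)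
Lemma sqr_cabs_KernE (z : R[i]) (w : R * R) :
  cabs (Kern alpha z (toC w)) ^+ 2 * expR (- (alpha * sqn w)) =
  expR (alpha * cabs z ^+ 2) * gauss alpha (toR2 z) w.
Proof.
rewrite cabs_Kern cabs2 -expRM_natl /gauss -!expRD; congr expR.
by rewrite /sqn /=; ring.
Qed.

Lemma condM_heat_lty : condM alpha mu -> forall z, (heat mu alpha z < +oo)%E.
Proof.
move=> cM [x y]; have := cM (x +i* y).
under eq_integral do rewrite sqr_cabs_KernE EFinM.
rewrite ge0_integralZl_EFin//; last 2 first.
- by move=> w _; rewrite lee_fin gauss_ge0.
- by apply/measurable_EFinP; exact: measurable_gauss.
rewrite -/(heat mu alpha (x, y)) => H.
rewrite ltey; apply/eqP => E; move: H; rewrite E mulry gtr0_sg ?expR_gt0//.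
by rewrite mul1e ltxx.
Qed.

(** The two exponents differ by [alpha / 2] times the squared distance from [z] to [w]. *)
Lemma Kern_fock_le (z : R[i]) :
  fock_le alpha (Kern alpha z) (expR (alpha / 2 * cabs z ^+ 2)).
Proof.
move=> w; rewrite cabs_Kern -expRD ler_expR !cabs2 -subr_ge0.
rewrite (_ : _ - _ = alpha / 2 * ((complex.Re z - complex.Re w) ^+ 2 +
  (complex.Im z - complex.Im w) ^+ 2)); last by field.
by rewrite mulr_ge0 ?addr_ge0 ?sqr_ge0// divr_ge0// ltW.
Qed.

Lemma toeplitz_bounded_heat : condM alpha mu -> toeplitz_bounded alpha mu ->
  exists C, forall z, (heat mu alpha z <= C%:E)%E.
Proof.
move=> cM [C HC]; exists C => -[x y]; pose z := x +i* y.
have Kz : in_Finf alpha (Kern alpha z).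
  by split; [exact: entire_Kern|eexists; exact: Kern_fock_le].
have [_ [_ /(_ _ (Kern_fock_le z) z)]] := HC _ Kz.
(* Since [fine] sends [+oo] to 0, finiteness is what recovers the average from the real-valued
   integral. *)
have fin : heat mu alpha (x, y) \is a fin_num.
  by rewrite ge0_fin_numE ?condM_heat_lty// heat_ge0.
rewrite (_ : - (alpha * cabs z ^+ 2) / 2 = - (alpha / 2 * cabs z ^+ 2)); last by field.
rewrite expRN ler_pdivrMr ?expR_gt0// -[leRHS]mulrA -expRD.
(* The bound on the kernel and the weight contribute one half each; together they cancel the
   exponential in the value of [toeplitz], leaving [C] itself. *)
have -> : alpha / 2 * cabs z ^+ 2 + alpha / 2 * cabs z ^+ 2 = alpha * cabs z ^+ 2 by field.
move=> /(le_trans (Re_le_cabs _))/(le_trans (ler_norm _)) /=.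
have -> : (\int[mu]_w complex.Re (toep_integrand alpha (Kern alpha z) z w))%R =
    expR (alpha * cabs z ^+ 2) * fine (heat mu alpha (x, y)).
  rewrite /Rintegral (eq_integral
    (fun w => (expR (alpha * cabs z ^+ 2))%:E * (gauss alpha (x, y) w)%:E)%E).
    rewrite ge0_integralZl_EFin//; last 2 first.
    - by move=> w _; rewrite lee_fin gauss_ge0.
    - by apply/measurable_EFinP; exact: measurable_gauss.
    by rewrite fineM.
  move=> w _; rewrite -EFinM -[(x, y)]/(toR2 z) -sqr_cabs_KernE toep_integrandE cabs2.
  by congr _%:E; case: (Kern _ _ _) => u v /=; ring.
by rewrite mulrC ler_pM2r ?expR_gt0// -lee_fin fineK.
Qed.

(** [gaussian_smoothing] is applied to the first coordinate with the narrow Gaussian in the second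
    as [g], then to the second with the widened Gaussian in the first; each pass divides the bound
    by [c]. *)
Lemma heat_smoothing (m : {sigma_finite_measure set (R * R)%type -> \bar R}) C :
  (forall z, (heat m alpha z <= C%:E)%E) ->
  exists C', forall z, (heat m (alpha / 2) z <= C'%:E)%E.
Proof.
move=> HC; have [c c0 Hc] := gaussian_smoothing m alpha0.
have mexp a (p : R * R -> R) t : measurable_fun setT p ->
    measurable_fun setT (fun w => expR (- (a * (t - p w) ^+ 2))).
  move=> mp; apply: measurableT_comp; first exact: measurable_expR.
  apply: measurableT_comp => //; apply: measurable_funM => //.
  by apply: measurable_funX; apply: measurable_funB.
exists (C / c / c) => -[x y].
have H1 (x' y' : R) : (\int[m]_w (expR (- (alpha / 2 * (x' - w.1) ^+ 2)) *
    expR (- (alpha * (y' - w.2) ^+ 2)))%:E <= (C / c)%:E)%E.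
  apply: (Hc fst (fun w => expR (- (alpha * (y' - w.2) ^+ 2)))) => //.
  - exact: mexp.
  move=> t; apply: le_trans (HC (t, y')); rewrite le_eqVlt; apply/orP; left; apply/eqP.
  apply: eq_integral => w _; rewrite -expRD /gauss /sqn /=.
  by congr (expR _)%:E; ring.
have := Hc snd (fun w => expR (- (alpha / 2 * (x - w.1) ^+ 2))) (C / c) _ _ _ _ y.
rewrite /heat; under [X in (_ -> _ -> _ -> _ -> (X <= _)%E) -> _]eq_integral => w _.
  rewrite -expRD (_ : _ + _ = - (alpha / 2 * sqn (x - w.1, y - w.2))); last first.
    by rewrite /sqn /=; ring.
  over.
apply => //; first exact: mexp.
move=> t; apply: le_trans (H1 x t); rewrite le_eqVlt; apply/orP; left; apply/eqP.
by apply: eq_integral => w _; rewrite mulrC.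
Qed.

Lemma measurable_heat (m : {sigma_finite_measure set (R * R)%type -> \bar R}) b :
  measurable_fun setT (heat m b).
Proof.
apply: (measurable_fun_fubini_tonelli_F (fun x => (gauss b x.1 x.2)%:E)).
  by apply/measurable_EFinP; exact: measurable_gauss2.
by move=> x; rewrite lee_fin gauss_ge0.
Qed.

End Berezin.

Unset Implicit Arguments.

Theorem theorem4p1 (R : realType) (alpha : R)
  (mu : {measure set (R * R)%type -> \bar R}) :
  0 < alpha -> condM alpha mu ->
  toeplitz_bounded alpha mu <-> Linfty_area (mu_tilde alpha 1 mu).
Proof.
move=> alpha0 cM; have api : 0 < alpha / pi :> R by rewrite divr_gt0// pi_gt0.
split=> [Tb|[_ [M HM]]].
  (* Condition (M) makes a positive Gaussian integrable, which is enough for sigma-finiteness. *)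
  have sf : sigma_finite setT mu.
    apply: (@integrable_gt0_sigma_finite _ _ _ _ (gauss alpha (0, 0))).
    - exact: measurable_gauss.
    - by move=> w; exact: expR_gt0.
    - exact: condM_heat_lty.
  pose m : {sigma_finite_measure set (R * R)%type -> \bar R} := sigma_finite_of sf.
  have [C HC] := toeplitz_bounded_heat alpha0 cM Tb.
  have [C' HC'] := @heat_smoothing R alpha alpha0 m C HC.
  have mE : mu_tilde alpha 1 mu = (fun z => (alpha / pi)%:E * heat m (alpha / 2) z)%E.
    by apply/funext => z; rewrite mu_tildeE.
  split; first by rewrite mE; apply: measurable_funeM; exact: measurable_heat.
  exists (alpha / pi * C'); apply: aeW => z; rewrite mE /=.
  rewrite gee0_abs ?mule_ge0 ?heat_ge0 ?lee_fin ?(ltW api)//.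
  by rewrite (EFinM (alpha / pi)); apply: lee_wpmul2l; rewrite ?lee_fin ?(ltW api).
have HM' : {ae (@lebesgue_measure R \x @lebesgue_measure R)%E,
    forall z, (heat mu (alpha / 2) z <= (M / (alpha / pi))%:E)%E}.
  have [N [mN N0 HN]] := HM; exists N; split => // z Hz; apply: HN => Hz'; apply: Hz.
  move: Hz'; rewrite /mkset mu_tildeE gee0_abs; last first.
    by rewrite mule_ge0 ?heat_ge0 ?lee_fin ?(ltW api).
  by rewrite (EFinM M) lee_pdivlMr// muleC.
have HC := heat_bounded (divr_gt0 alpha0 (ltr0Sn _ 1)) HM'.
(* The constant is fixed by [toeplitz_fock_le] in the last goal; it is twice the bound in [HC],
   hence independent of [f]. *)
eexists => f [ef [M0 fM0]]; split; [|split].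
- by move=> z; exact: (toep_definedP alpha0 HC z ef fM0).
- exact: (toeplitz_entire alpha0 HC ef fM0).
- by move=> M1 fM1; exact: (toeplitz_fock_le alpha0 HC ef fM1).
Qed.
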